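(* Let $n$ be a positive integer, let $E$ be an arbitrary subset of $\mathbb{R}^n$, and let $f: E \to \mathbb{R}^n$ be a continuous map that is zero-free on the interior $E^\circ$ of $E$ in $\mathbb{R}^n$. Then $f$ can be approximated uniformly by a continuous $\mathbb{R}^n$-valued map that is zero-free on all of $E$; that is, for every real $\varepsilon>0$ there is a continuous map $g:E\to\mathbb{R}^n$ such that $g(x)\neq 0$ for every $x\in E$ and $|f(x)-g(x)|<\varepsilon$ for every $x\in E$.
   Context: $|\cdot|$ denotes the Euclidean norm on $\mathbb{R}^n$. A map $f$ into $\mathbb{R}^n$ is zero-free on a set $L$ if $f(x)\neq 0$ for every $x\in L$. $E$ carries the subspace topology. *)

(* Defs.v *)
From HB Require Import structures.
From mathcomp Require Import all_boot all_order all_algebra.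
From mathcomp Require Import all_classical all_reals all_analysis.

Set Implicit Arguments.
Unset Strict Implicit.
Unset Printing Implicit Defensive.

Import Order.TTheory GRing.Theory Num.Theory.
Import numFieldNormedType.Exports.

Local Open Scope ring_scope.

(* The norm `|x| that MathComp-Analysis puts on matrices is the sup norm, so
   the Euclidean norm is introduced separately. The topology on 'rV[R]_n is the
   entrywise (product) one, which both norms induce. *)
Definition enorm (R : realType) (n : nat) (x : 'rV[R]_n) : R :=
  Num.sqrt (\sum_(i < n) x 0 i ^+ 2).

Definition zero_free_on (R : realType) (n : nat) (L : set 'rV[R]_n)
    (f : 'rV[R]_n -> 'rV[R]_n) : Prop :=
  forall x, L x -> f x != 0.

(* Main.v *)
From HB Require Import structures.
Require Import Defs.
From mathcomp Require Import all_boot all_order all_algebra.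
From mathcomp Require Import all_classical all_reals all_analysis.
From mathcomp Require Import ring lra zify.

Set Implicit Arguments.
Unset Strict Implicit.
Unset Printing Implicit Defensive.

Import Order.TTheory GRing.Theory Num.Theory.
Import numFieldNormedType.Exports.

Local Open Scope classical_set_scope.
Local Open Scope ring_scope.

(** Write |.| for the sup norm, Z for the zero set of f and fix a tolerance e.
Interior points of E are not in Z, so points of the complement of E accumulate
at every point of Z: near Z a zero can be moved into a hole of E.

For each coordinate j let A_j+ (resp. A_j-) be the set of the points of E where
f_j = |f| (resp. f_j = - |f|).  In E these two sets meet only in Z.  In the
ambient space their closures may meet elsewhere; let S be the union over j of
the intersections of the closures.  Then S meets E exactly in Z, so every point
of S is a limit of points outside E.  Let T be the set of the points of E where
|f| >= e.  The part of S off the closure of T is covered by small closed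
sup-norm balls that avoid the closure of T, are centred at points p_k outside E,
and form a family that is locally finite at the points of E
(locally_finite_ball_cover).

Remove the open balls from the sets A_j+ and A_j-.  No point of E or of a ball
is now in both closures, and the Urysohn functions of these pairs, made of
distance functions, are the coordinates of a map H.  Outside the balls,
H has at each point of E a coordinate equal to +1 or -1 with the sign of the
corresponding nonzero coordinate of f.  H is Lipschitz on countably many sets
that exhaust its domain, and the boundaries of the balls are finite unions of
flat pieces of dimension n - 1; a Lipschitz image of such a piece is nowhere
dense (lipschitz_flat_nowhere_dense), so by Baire some arbitrarily small v is
missed by H on all these boundaries (urysohn_map_generic).

Now H - v has no zero on the boundary of a ball.  Radial projection of each ball
from its centre p_k onto its boundary, one ball after the other, changes H - v
into a map G that is defined off the centres p_k, hence on E, that is zero-free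
in the balls and unchanged elsewhere (push_zeros_off).  Finally g interpolates
between f where |f| >= 2 e and e G where |f| <= e.  Inside the balls |f| < e, so
there g = e G; outside the balls some coordinate of f and of G have the same
sign, and no cancellation occurs. *)

(** * The sup norm and truncated distances *)

Lemma coord_le_norm (R : realType) n (x : 'rV[R]_n) i : `|x 0 i| <= `|x|.
Proof.
rewrite [leRHS]/Num.norm /= mx_normrE.
exact: (le_bigmax _ (fun ij => `|x ij.1 ij.2|) (0, i)).
Qed.

Lemma norm_le_coord (R : realType) n (x : 'rV[R]_n) c :
  0 <= c -> (forall i, `|x 0 i| <= c) -> `|x| <= c.
Proof.
move=> c0 xc; rewrite [leLHS]/Num.norm /= mx_normrE.
by apply: bigmax_le => // -[i j] _; rewrite /= ord1.
Qed.

Lemma norm_coord (R : realType) n (x : 'rV[R]_n.+1) :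
  exists i, `|x| = `|x 0 i|.
Proof.
have [->|x0] := eqVneq x 0; first by exists ord0; rewrite mxE !normr0.
have /mx_norm_neq0[[i j] e] : mx_norm x != 0 by rewrite -[mx_norm x]/`|x| normr_eq0.
by exists j; rewrite [LHS]/Num.norm /= e ord1.
Qed.

(** The extra value 1 makes the infimum meaningful for the empty set, and keeps
the function 1-Lipschitz. *)
Definition tdist (R : realType) (V : normedModType R) (A : set V) (x : V) : R :=
  inf ([set 1] `|` [set `|x - a| | a in A]).

Section TruncatedDistance.
Variables (R : realType) (V : normedModType R).
Implicit Types (A B : set V) (x y a : V).

Lemma tdist_ge A x c :
  c <= 1 -> (forall a, A a -> c <= `|x - a|) -> c <= tdist A x.
Proof.
move=> c1 cA; apply: lb_le_inf; first by exists 1; left.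
by move=> r [->//|[a Aa <-]]; apply: cA.
Qed.

Let tdist_lb A x : has_lbound ([set 1] `|` [set `|x - a| | a in A]).
Proof. by exists 0 => r [->//|[a _ <-]]. Qed.

Lemma tdist_le A x a : A a -> tdist A x <= `|x - a|.
Proof. by move=> Aa; apply: ge_inf; [exact: tdist_lb|right; exists a]. Qed.

Lemma tdist_le1 A x : tdist A x <= 1.
Proof. by apply: ge_inf; [exact: tdist_lb|left]. Qed.

Lemma tdist_ge0 A x : 0 <= tdist A x.
Proof. exact: tdist_ge. Qed.

Lemma tdist0 A x : A x -> tdist A x = 0.
Proof.
by move=> Ax; apply/le_anti; rewrite tdist_ge0 andbT -(normr0 V) -(subrr x) tdist_le.
Qed.

Lemma tdist_sub A B x : A `<=` B -> tdist B x <= tdist A x.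
Proof.
move=> AB; apply: tdist_ge; first exact: tdist_le1.
by move=> a /AB; exact: tdist_le.
Qed.

Lemma tdist_leD A x y : tdist A x <= tdist A y + `|x - y|.
Proof.
rewrite -lerBlDr; apply: tdist_ge => [|a Aa].
  by rewrite lerBlDr (le_trans (tdist_le1 _ _))// lerDl.
by rewrite lerBlDr (le_trans (tdist_le _ Aa))// [leRHS]addrC ler_distD.
Qed.

Lemma tdist_lip A x y : `|tdist A x - tdist A y| <= `|x - y|.
Proof.
have := tdist_leD A x y; have := tdist_leD A y x.
by rewrite (distrC y) ler_norml => ? ?; lra.
Qed.

Lemma tdist_eq0_near A x e : tdist A x = 0 -> 0 < e ->
  exists2 a, A a & `|x - a| < e.
Proof.
move=> xA e0; apply: contrapT => noa.
suff : Num.min e 1 <= tdist A x by rewrite xA leNgt lt_min e0 ltr01.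
apply: tdist_ge => [|a Aa]; first by rewrite ge_min lexx orbT.
rewrite ge_min; apply/orP; left; rewrite leNgt; apply/negP => xa.
by apply: noa; exists a.
Qed.

End TruncatedDistance.

(** A set of the form E /\ 0 <= phi is closed in E when phi is continuous on E;
being at distance zero stands for membership of the closure. *)
Lemma tdist_superlevel (R : realType) (V : normedModType R) (E : set V)
    (phi : V -> R) x :
  E x -> phi y @[y --> within E (nbhs x)] --> phi x ->
  tdist [set y | E y /\ 0 <= phi y] x = 0 -> 0 <= phi x.
Proof.
move=> Ex cphi dx; rewrite leNgt; apply/negP => phix.
have : \forall y \near within E (nbhs x), phi y < 0.
  exact: (cvgr_lt _ cphi).
rewrite near_withinE => /nbhs_normP[e /= e0 He].
have [a [Ea pa] xa] := tdist_eq0_near dx e0.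
by have := He a xa Ea; rewrite ltNge pa.
Qed.

(** * Generic values of Lipschitz maps on flat pieces *)

(** A count of dimensions.  If every value of a grid of q ^ n.+1 points w a of
mesh d / (2 q) were almost attained on the flat piece K, then the points of K
attaining them would be separated by a multiple of 1 / q; but K has only n
free coordinates, hence room for a number of such points that grows like q ^ n.
The conclusion bounds the distance to w from below, so that the values that are
avoided in this sense form an open set. *)
Lemma lipschitz_flat_nowhere_dense (R : realType) n (K : set 'rV[R]_n.+1)
    (H : 'rV[R]_n.+1 -> 'rV[R]_n.+1) j c p rho L w0 d :
  0 < L -> 0 <= rho -> 0 < d ->
  (forall x, K x -> x 0 j = c) -> (forall x, K x -> `|x - p| <= rho) ->
  (forall x y, K x -> K y -> `|H x - H y| <= L * `|x - y|) ->
  exists w eta, [/\ `|w - w0| < d, 0 < eta & forall x, K x -> eta <= `|H x - w|].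
Proof.
move=> L0 rho0 d0 Kj Kp KL; apply: contrapT => noW.
have near_img w eta : `|w - w0| < d -> 0 < eta -> exists x, K x /\ `|H x - w| < eta.
  move=> wd eta0; apply: contrapT => nox; apply: noW; exists w, eta; split => // x Kx.
  by rewrite leNgt; apply/negP => xw; apply: nox; exists x.
(* With cells of side h below, K has at most (q * D).+1 cells in each of its n
   free directions. *)
pose D := (Num.truncn (8 * rho * L / d)).+1.
have DC : 8 * rho * L / d < D%:R by exact: truncnS_gt.
(* The choice of q makes q ^ n.+1 exceed (q * D.+1) ^ n. *)
pose q := (D.+1 ^ n).+1.
have q0 : 0 < q%:R :> R by rewrite ltr0n.
pose w (a : {ffun 'I_n.+1 -> 'I_q}) : 'rV[R]_n.+1 :=
  \row_i (w0 0 i + d / 2 * ((a i)%:R / q%:R)).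
have wd a : `|w a - w0| < d.
  apply: (@le_lt_trans _ _ (d / 2)); last by rewrite ltr_pdivrMr// ltr_pMr// ltr1n.
  apply: norm_le_coord => [|i]; first by rewrite divr_ge0 // ltW.
  rewrite !mxE addrC addKr ger0_norm ?mulr_ge0 ?divr_ge0 ?(ltW d0)//.
  by rewrite ler_piMr ?divr_ge0 ?(ltW d0)// ler_pdivrMr// mul1r ler_nat ltnW.
have eta0 : 0 < d / (8 * q%:R) by rewrite divr_gt0// mulr_gt0.
have [x xP] := choice (fun a => near_img (w a) _ (wd a) eta0).
pose h := d / (4 * q%:R * L).
have h0 : 0 < h by rewrite divr_gt0// !mulr_gt0.
pose t (y : 'rV[R]_n.+1) i := (y 0 i - p 0 i + rho) / h.
have t_ge0 y i : K y -> 0 <= t y i.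
  move=> Ky; rewrite divr_ge0 ?(ltW h0)//.
  have := le_trans (coord_le_norm (y - p) i) (Kp _ Ky).
  by rewrite !mxE ler_norml => /andP[+ _]; rewrite -subr_ge0 opprK.
have t_le y i : K y -> t y i < (q * D)%:R.
  move=> Ky; have := le_trans (coord_le_norm (y - p) i) (Kp _ Ky).
  rewrite !mxE ler_norml => /andP[_ yp].
  apply: (@le_lt_trans _ _ (2 * rho / h)).
    by rewrite ler_pM2r ?invr_gt0//; lra.
  rewrite natrM (_ : 2 * rho / h = q%:R * (8 * rho * L / d)) ?ltr_pM2l//.
  by rewrite /h; field; rewrite !gt_eqF.
(* The constant coordinate j is dropped. *)
pose cell a : {ffun 'I_n -> 'I_(q * D).+1} :=
  [ffun i => inord (Num.truncn (t (x a) (lift j i)))].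
have cell_inj : injective cell.
  move=> a b eab; apply/ffunP => i; apply/eqP; apply: contrapT => /negP nab.
  have [[Ka Ha] [Kb Hb]] := (xP a, xP b).
  have wab : d / (2 * q%:R) <= `|w a - w b|.
    apply: le_trans (coord_le_norm _ i); rewrite !mxE.
    rewrite (_ : _ - _ = d / (2 * q%:R) * ((a i)%:R - (b i)%:R)); last first.
      by field; rewrite gt_eqF.
    rewrite normrM ger0_norm; last by rewrite divr_ge0 ?mulr_ge0 ?(ltW d0).
    rewrite ler_peMr ?divr_ge0 ?mulr_ge0 ?(ltW d0)//.
    have : (a i : nat) != b i by [].
    case: ltngtP => // ab _.
      by rewrite distrC -natrB ?(ltnW ab)// normr_nat ler1n subn_gt0.
    by rewrite -natrB ?(ltnW ab)// normr_nat ler1n subn_gt0.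
  have Hab : d / (4 * q%:R) <= `|H (x a) - H (x b)|.
    have := ler_distD (H (x a)) (w a) (w b); rewrite (distrC (w a) (H _)).
    have := ler_distD (H (x b)) (H (x a)) (w b).
    have -> : d / (4 * q%:R) = d / (2 * q%:R) - d / (8 * q%:R) - d / (8 * q%:R).
      by field; rewrite gt_eqF.
    by move=> ? ?; lra.
  have xab : `|x a - x b| < h.
    have [k ->] := norm_coord (x a - x b).
    rewrite !mxE; have [->|[k' ->]] : k = j \/ exists k', k = lift j k'.
      by have [k' ->|->] := unliftP j k; [right; exists k'|left].
      by rewrite !Kj// subrr normr0.
    have /ffunP/(_ k') := eab; rewrite !ffunE => /(congr1 val).
    have cellP y : K y -> Num.truncn (t y (lift j k')) =
        @inord (q * D) (Num.truncn (t y (lift j k'))) :> nat.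
      by move=> Ky; rewrite inordK// ltnS ltnW// truncn_lt_nat ?t_ge0 ?t_le.
    rewrite /= -!cellP// => et.
    have := truncn_itv (t_ge0 _ (lift j k') Ka).
    have := truncn_itv (t_ge0 _ (lift j k') Kb).
    rewrite et -natr1 => /andP[tb1 tb2] /andP[ta1 ta2].
    rewrite (_ : _ - _ = h * (t (x a) (lift j k') - t (x b) (lift j k'))); last first.
      by rewrite /t; field; rewrite gt_eqF.
    rewrite normrM gtr0_norm// gtr_pMr// ltr_norml; lra.
  have := le_trans Hab (KL _ _ Ka Kb).
  rewrite leNgt (_ : d / (4 * q%:R) = L * h) ?ltr_pM2l ?xab//.
  by rewrite /h; field; rewrite !gt_eqF.
have := leq_card _ cell_inj; rewrite !card_ffun !card_ord leqNgt.
suff -> : ((q * D).+1 ^ n < q ^ n.+1)%N by [].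
apply: (@leq_ltn_trans ((q * D.+1) ^ n)).
  by case: (n) => // m; rewrite leq_exp2r// mulnS -addn1 addnC leq_add2r.
by rewrite expnMn expnSr ltn_pmul2l ?expn_gt0.
Qed.

(** Makes row vectors a complete normed module, the setting of Baire's theorem. *)
HB.instance Definition _ (R : realType) (m n : nat) :=
  Complete.on 'M[R]_(m.+1, n.+1).

(** Baire: the values staying at a positive distance from the image of K i form
a dense open set. *)
Lemma avoid_countable_images (R : realType) (V : completeNormedModType R)
    (T : Type) (I : countType) (K : I -> set T) (H : T -> V) :
  (forall i w0 (d : R), 0 < d -> exists w eta,
    [/\ `|w - w0| < d, 0 < eta & forall x, K i x -> eta <= `|H x - w|]) ->
  forall w0 (d : R), 0 < d ->
  exists2 v, `|v - w0| < d & forall i x, K i x -> H x != v.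
Proof.
move=> Knd w0 d d0.
pose F k : set V := [set v | forall i : I, unpickle k = Some i ->
  exists2 eta : R, 0 < eta & forall x, K i x -> eta <= `|H x - v|].
have FP k : open (F k) /\ dense (F k).
  split.
    rewrite openE => v Fv; case ki : (unpickle k) => [i|]; last first.
      by apply: filterE => u i; rewrite ki.
    have [eta eta0 Hv] := Fv i ki.
    apply/nbhs_normP; exists (eta / 2) => /=; first by rewrite divr_gt0.
    move=> u /= vu i' ; rewrite ki => -[<-].
    exists (eta / 2); first by rewrite divr_gt0.
    move=> x /Hv; have := ler_distD u (H x) v; rewrite (distrC u v) => ? ?; lra.
  move=> O [u Ou] oO; have /nbhs_normP[e /= e0 eO] := open_nbhs_nbhs (conj oO Ou).
  case ki : (unpickle k) => [i|]; last by exists u; split => // i; rewrite ki.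
  have [w [eta [wu eta0 Hw]]] := Knd i u e e0.
  exists w; split; first by apply: eO; rewrite /= distrC.
  by move=> i'; rewrite ki => -[<-]; exists eta.
have : open [set v : V | `|v - w0| < d].
  rewrite openE => v /= vd; apply/nbhs_normP; exists (d - `|v - w0|) => /=.
    by rewrite subr_gt0.
  move=> u /= uv; have := ler_distD v u w0; rewrite (distrC u v); lra.
have := Baire FP => /[apply] -[|v [vd Fv]].
  by exists w0; rewrite /= subrr normr0.
exists v => // i x Kx; apply/eqP => Hxv.
have [eta eta0 /(_ x Kx)] := Fv (pickle i) Logic.I i (pickleK i).
by rewrite Hxv subrr normr0 leNgt eta0.
Qed.

(** * Pushing zeros into the centres of balls *)

Section Push.
Variables (R : realType) (V : normedModType R).
Implicit Types (p y : V) (r : R).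

(** Radial projection of the closed ball of centre p and radius r onto its
boundary, extended by the identity; the maximum with 1 makes it a single
formula.  It is continuous off p, and it is the identity if r < 0, so
that a negative radius encodes an absent ball. *)
Definition push p r y : V := p + Num.max 1 (r / `|y - p|) *: (y - p).

Lemma push_out p r y : r <= `|y - p| -> push p r y = y.
Proof.
move=> ry; suff h : r / `|y - p| <= 1 by rewrite /push max_l// scale1r addrC subrK.
have [->|yp] := eqVneq y p; first by rewrite subrr normr0 invr0 mulr0.
by rewrite ler_pdivrMr ?normr_gt0 ?subr_eq0// mul1r.
Qed.

Lemma push_sphere p r y : (0 < r -> y != p) -> `|y - p| <= r ->
  `|push p r y - p| = r.
Proof.
move=> yp yr; have [r0|r0] := ltP 0 r.
  have yp0 : 0 < `|y - p| by rewrite normr_gt0 subr_eq0 yp.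
  rewrite /push addrC addKr max_r ?ler_pdivlMr ?mul1r//.
  by rewrite normrZ ger0_norm ?divr_ge0 ?(ltW r0)// divfK// gt_eqF.
have r_eq0 : r = 0 by apply/le_anti; rewrite r0 (le_trans _ yr).
by move: yr; rewrite r_eq0 normr_le0 subr_eq0 => /eqP ->; rewrite push_out subrr normr0.
Qed.

Lemma push_continuous p r y : (0 < r -> y != p) -> {for y, continuous (push p r)}.
Proof.
move=> yp; have [r0|r0] := ltP 0 r; last first.
  have -> : push p r = id by apply/funext => z; rewrite push_out// (le_trans r0).
  exact: cvg_id.
have sub_cvg : {for y, continuous (fun z => z - p)} by apply: cvgB; [exact: cvg_id|exact: cvg_cst].
apply: cvgD; first exact: cvg_cst.
apply: (@cvgZ _ _ _ _ _ (fun z => Num.max 1 (r / `|z - p|)) (fun z => z - p)) => //.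
apply: (@continuous_max _ _ (fun=> 1) (fun z => r / `|z - p|)); first exact: cvg_cst.
apply: cvgM; first exact: cvg_cst.
by apply: cvgV; [rewrite gt_eqF// normr_gt0 subr_eq0 yp|exact: cvg_norm].
Qed.

Variables (W : normedModType R) (p_ : nat -> V) (r_ : nat -> R) (g : V -> W).

(** The last ball acts first: the value at a point off all balls of index at
least k is therefore final from stage k on. *)
Fixpoint pushed k : V -> W :=
  if k is k'.+1 then pushed k' \o push (p_ k') (r_ k') else g.

Lemma pushed_stable m k y : (m <= k)%N ->
  (forall i, (m <= i < k)%N -> r_ i <= `|y - p_ i|) -> pushed k y = pushed m y.
Proof.
elim: k => [|k IHk]; first by rewrite leqn0 => /eqP ->.
rewrite leq_eqVlt => /predU1P[->//|]; rewrite ltnS => mk yr /=.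
rewrite push_out ?yr ?mk ?ltnSn// IHk// => i /andP[mi ik].
by rewrite yr// mi ltnW.
Qed.

Lemma pushed_bound c k y : (forall z, `|g z| <= c) -> `|pushed k y| <= c.
Proof. by move=> gc; elim: k y => [|k IHk] y //=; exact: IHk. Qed.

Variable Omega : set V.
(* Projecting onto a later boundary must not hit an earlier centre, where the
   map is no longer controlled. *)
Hypothesis centre_sphere : forall i k, (i < k)%N -> 0 < r_ i -> `|p_ i - p_ k| != r_ k.
Hypothesis sphere_free : forall k y, `|y - p_ k| = r_ k -> Omega y /\ g y != 0.
Hypothesis g_cont : forall y, Omega y -> {for y, continuous g}.

Let D k : set V := [set y | Omega y /\ forall i, (i < k)%N -> 0 < r_ i -> y != p_ i].

Let D_push k y : D k.+1 y -> D k (push (p_ k) (r_ k) y).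
Proof.
move=> [Oy yp]; have [yr|/ltW yr] := leP (`|y - p_ k|) (r_ k); last first.
  by rewrite push_out//; split => // i ik; apply: yp; exact: ltnW.
have e := push_sphere (yp k (ltnSn k)) yr.
split; first by have [] := sphere_free e.
move=> i ik ri; apply: contra_eq_neq e => ->; exact: centre_sphere.
Qed.

Lemma pushed_continuous k y : D k y -> {for y, continuous (pushed k)}.
Proof.
elim: k y => [|k IHk] y Dy /=; first by apply: g_cont; case: Dy.
apply: continuous_comp; last exact/IHk/D_push.
by apply: push_continuous; case: Dy => _; apply.
Qed.

(** Freeness on the boundaries is preserved: a boundary point lying in ball k
takes its value at a point of the boundary of ball k. *)
Lemma pushed_sphere k j y : D k y -> `|y - p_ j| = r_ j -> pushed k y != 0.
Proof.
elim: k j y => [|k IHk] j y Dy yj /=; first by have [] := sphere_free yj.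
have [yr|/ltW yr] := leP (`|y - p_ k|) (r_ k); last first.
  by apply: (IHk j); [exact: D_push|rewrite push_out].
apply: (IHk k); first exact: D_push.
by apply: push_sphere => //; case: Dy => _; apply.
Qed.

Lemma pushed_ball k i y : D k y -> (i < k)%N -> `|y - p_ i| <= r_ i -> pushed k y != 0.
Proof.
elim: k y => [|k IHk] y Dy //=; rewrite ltnS leq_eqVlt => ik yi.
have [yr|yr] := leP (`|y - p_ k|) (r_ k).
  apply: (@pushed_sphere _ k); first exact: D_push.
  by apply: push_sphere => //; case: Dy => _; apply.
apply: IHk; first exact: D_push.
  by case/predU1P : ik => // ik; move: yi yr; rewrite ik leNgt => /negbTE ->.
by rewrite push_out// ltW.
Qed.

(** Radial extension replaces the values in a ball by values on its boundary, at
the price of the centre.  Since the family is locally finite along E, the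
successive modifications are eventually constant near each point of E. *)
Lemma push_zeros_off (E : set V) c :
  (forall z, `|g z| <= c) ->
  (forall x, E x -> Omega x /\ forall i, 0 < r_ i -> x != p_ i) ->
  (forall x, E x -> exists N d, 0 < d /\
     forall k y, (N <= k)%N -> `|y - x| < d -> r_ k < `|y - p_ k|) ->
  exists G : V -> W,
    [/\ forall x, E x -> G y @[y --> within E (nbhs x)] --> G x,
        forall x i, E x -> `|x - p_ i| <= r_ i -> G x != 0,
        forall x, E x -> (forall i, r_ i < `|x - p_ i|) -> G x = g x &
        forall x, `|G x| <= c].
Proof.
move=> gc EO lf.
have /choice[N NP] : forall x, exists N, E x -> exists2 d, 0 < d &
    forall k y, (N <= k)%N -> `|y - x| < d -> r_ k < `|y - p_ k|.
  move=> x; have [Ex|nEx] := pselect (E x); last by exists 0%N.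
  by have [N [d [d0 H]]] := lf x Ex; exists N => _; exists d.
have ED x k : E x -> D k x.
  by move=> Ex; have [Ox xp] := EO _ Ex; split => // i _; exact: xp.
pose G x := pushed (N x) x.
have GE x k : E x -> (N x <= k)%N -> G x = pushed k x.
  move=> Ex Nk; rewrite /G; apply/esym/pushed_stable => // i /andP[Ni _].
  by have [d d0 H] := NP _ Ex; rewrite ltW// H// subrr normr0.
exists G; split.
- move=> x Ex; have [d d0 H] := NP _ Ex.
  apply: (@cvg_trans _ (pushed (N x) y @[y --> within E (nbhs x)])); last first.
    by apply: cvg_within_filter; apply: pushed_continuous; exact: ED.
  apply: near_eq_cvg; rewrite near_withinE; apply/nbhs_normP; exists d => //= y xy Ey.
  rewrite (GE _ (maxn (N x) (N y)))// ?leq_maxr//.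
  apply/esym/pushed_stable; first exact: leq_maxl.
  by move=> i /andP[Ni _]; rewrite ltW// H// distrC.
- move=> x i Ex xi; rewrite (GE _ (maxn (N x) i.+1))// ?leq_maxl//.
  by apply: (@pushed_ball _ i) => //; [exact: ED|exact: leq_maxr].
- by move=> x Ex xr; rewrite /G (@pushed_stable 0) // => i _; exact: ltW.
- by move=> x; exact: pushed_bound.
Qed.

End Push.

(** * The separating map *)

Lemma pointwise_lipschitz_continuous (R : realType) (V W : normedModType R)
    (f : V -> W) x L : 0 < L -> (forall y, `|f y - f x| <= L * `|y - x|) ->
  {for x, continuous f}.
Proof.
move=> L0 fL; apply/cvgrPdist_lt => /= e e0; apply/nbhs_normP.
exists (e / L) => /=; first by rewrite divr_gt0.
move=> y /= xy; rewrite distrC; apply: le_lt_trans (fL y) _.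
by rewrite mulrC -ltr_pdivlMr// distrC.
Qed.

Section Urysohn.
Variables (R : realType) (V : normedModType R).
Implicit Types (A B : set V) (x y : V).

Definition urysohn_den A B x := tdist B x + tdist A x.

Definition urysohn A B x := (tdist B x - tdist A x) / urysohn_den A B x.

Lemma urysohn_den_ge0 A B x : 0 <= urysohn_den A B x.
Proof. by rewrite addr_ge0// tdist_ge0. Qed.

Lemma urysohn_le1 A B x : `|urysohn A B x| <= 1.
Proof.
have := urysohn_den_ge0 A B x; rewrite le_eqVlt => /predU1P[e|e].
  by rewrite /urysohn -e invr0 mulr0 normr0.
rewrite normrM normfV (gtr0_norm e) ler_pdivrMr// mul1r ler_norml /urysohn_den.
by have := tdist_ge0 A x; have := tdist_ge0 B x => ? ?; apply/andP; split; lra.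
Qed.

Lemma urysohn_left A B x : A x -> 0 < urysohn_den A B x -> urysohn A B x = 1.
Proof.
by rewrite /urysohn /urysohn_den => /tdist0 ->; rewrite subr0 addr0 => /gt_eqF e;
  rewrite divff ?e.
Qed.

Lemma urysohn_right A B x : B x -> 0 < urysohn_den A B x -> urysohn A B x = -1.
Proof.
by rewrite /urysohn /urysohn_den => /tdist0 ->; rewrite sub0r add0r => /gt_eqF e;
  rewrite mulNr divff ?e.
Qed.

(** The constant depends on the denominator at x only: at a point y where the
denominator vanishes, so does the function by convention, and then the
denominator at x is at most twice the distance from x to y. *)
Lemma urysohn_lip A B x y : 0 < urysohn_den A B x ->
  `|urysohn A B y - urysohn A B x| <= 4 / urysohn_den A B x * `|y - x|.
Proof.
move=> e0; have t0 := normr_ge0 (y - x).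
have /ler_normlP[A1 A2] := tdist_lip A y x.
have /ler_normlP[B1 B2] := tdist_lip B y x.
have /ler_normlP[uy1 uy2] := urysohn_le1 A B y.
rewrite mulrAC ler_pdivlMr// -(gtr0_norm e0) -normrM mulrBl.
have -> : urysohn A B x * urysohn_den A B x = tdist B x - tdist A x.
  by rewrite divfK// gt_eqF.
have [d0|d0] := eqVneq (urysohn_den A B y) 0.
  rewrite /urysohn d0 invr0 mulr0 mul0r sub0r normrN.
  have := tdist_ge0 A x; have := tdist_ge0 B x; rewrite /urysohn_den in d0 *.
  by rewrite ler_norml => ? ?; apply/andP; split; lra.
have uyE : urysohn A B y * urysohn_den A B y = tdist B y - tdist A y by rewrite divfK.
have -> : urysohn A B y * urysohn_den A B x = tdist B y - tdist A y +
    urysohn A B y * (urysohn_den A B x - urysohn_den A B y) by rewrite -uyE; ring.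
have : `|urysohn A B y * (urysohn_den A B x - urysohn_den A B y)| <= 2 * `|y - x|.
  rewrite normrM -[leRHS]mul1r ler_pM ?urysohn_le1// ler_norml /urysohn_den.
  by apply/andP; split; lra.
by rewrite !ler_norml => /andP[? ?]; apply/andP; split; lra.
Qed.

End Urysohn.

Section UrysohnMap.
Variables (R : realType) (n : nat).
Local Notation X := 'rV[R]_n.+1.
Variables A B : 'I_n.+1 -> set X.

Definition urysohn_map (x : X) : X := \row_j urysohn (A j) (B j) x.

Lemma urysohn_map_le1 x : `|urysohn_map x| <= 1.
Proof. by apply: norm_le_coord => // j; rewrite mxE urysohn_le1. Qed.

Lemma urysohn_map_lip c x y :
  0 < c -> (forall j, c <= urysohn_den (A j) (B j) x) ->
  `|urysohn_map y - urysohn_map x| <= 4 / c * `|y - x|.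
Proof.
move=> c0 cx; apply: norm_le_coord => [|j]; first by rewrite mulr_ge0 ?divr_ge0 ?(ltW c0).
have dx : 0 < urysohn_den (A j) (B j) x by exact: lt_le_trans (cx j).
rewrite !mxE; apply: le_trans (urysohn_lip y dx) _.
by rewrite ler_wpM2r// ler_wpM2l// lef_pV2 ?posrE.
Qed.

Lemma urysohn_map_den_ge x : (forall j, 0 < urysohn_den (A j) (B j) x) ->
  exists q : nat, forall j, q.+1%:R^-1 <= urysohn_den (A j) (B j) x.
Proof.
move=> dx; pose q j := Num.truncn (urysohn_den (A j) (B j) x)^-1.
exists (\max_j q j) => j; rewrite invf_ple ?posrE//.
apply: le_trans (ltW (truncnS_gt _)) _.
by rewrite ler_nat ltnS; exact: (leq_bigmax j).
Qed.

Lemma urysohn_map_continuous x : (forall j, 0 < urysohn_den (A j) (B j) x) ->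
  {for x, continuous urysohn_map}.
Proof.
move=> /urysohn_map_den_ge[q qx].
have c0 : 0 < q.+1%:R^-1 :> R by rewrite invr_gt0 ltr0n.
apply: (pointwise_lipschitz_continuous (L := 4 / q.+1%:R^-1)).
  by rewrite divr_gt0.
by move=> y; exact: urysohn_map_lip.
Qed.

(** On the part of a face of a sphere where the denominators are at least 1 / q.+1
the map is Lipschitz, so its image there is nowhere dense; countably many such
parts exhaust the spheres. *)
Lemma urysohn_map_generic (p : nat -> X) (r : nat -> R) :
  (forall k y, `|y - p k| = r k -> forall j, 0 < urysohn_den (A j) (B j) y) ->
  exists2 v : X, `|v| < 1 / 2 &
    forall k y, `|y - p k| = r k -> urysohn_map y != v.
Proof.
move=> den_sphere.
pose face (i : nat * ('I_n.+1 * (bool * nat))) : set X :=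
  let: (k, (j, (b, q))) := i in
  [set y | [/\ `|y - p k| = r k, y 0 j = p k 0 j + (-1) ^+ b * r k &
     forall j', q.+1%:R^-1 <= urysohn_den (A j') (B j') y]].
have [||v vd vface] := @avoid_countable_images _ _ _ _ face urysohn_map _ 0 (1 / 2) => //.
  move=> [k [j [b q]]] w0 d d0.
  apply: (@lipschitz_flat_nowhere_dense _ _ _ _ j (p k 0 j + (-1) ^+ b * r k)
    (p k) `|r k| (4 / q.+1%:R^-1)) => //.
  - by move=> x [].
  - by move=> x [-> _ _]; exact: ler_norm.
  - by move=> x y _ [_ _ qy]; apply: urysohn_map_lip.
exists v; first by move: vd; rewrite subr0.
move=> k y yr; have [q qy] := urysohn_map_den_ge (den_sphere k y yr).
have [j yj] := norm_coord (y - p k).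
pose b := (y 0 j - p k 0 j < 0).
apply: (vface (k, (j, (b, q)))); split => //.
rewrite -yr yj !mxE /b; case: ltP => s.
  by rewrite ltr0_norm//= expr1; ring.
by rewrite ger0_norm//= expr0; ring.
Qed.

End UrysohnMap.

(** * Locally finite covers by balls centred outside a set *)

Lemma exists_between_notin (R : realFieldType) (l : seq R) (a b : R) :
  a < b -> exists2 x, a < x < b & x \notin l.
Proof.
elim: l b => [|y l IHl] b ab.
  by exists ((a + b) / 2) => //; apply/andP; split; lra.
pose b' := if a < y < b then y else b.
have ab' : a < b' by rewrite /b'; case: ifP => // /andP[].
have b'b : b' <= b by rewrite /b'; case: ifP => // /andP[_ /ltW].
have [x /andP[ax xb'] xl] := IHl _ ab'.
have xb : x < b by exact: lt_le_trans b'b.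
exists x; rewrite ?ax// in_cons negb_or xl andbT.
by apply/eqP => xy; move: xb'; rewrite /b' -xy ax xb ltxx.
Qed.

Lemma dyadic_scale (R : realType) (x : R) : 0 < x <= 1 ->
  exists e : nat, 8 * (2 ^+ e)^-1 <= x <= 16 * (2 ^+ e)^-1.
Proof.
move=> /andP[x0 x1].
have : exists e : nat, 8 * (2 ^+ e)^-1 <= x.
  exists (Num.truncn (8 / x)).+1; rewrite ler_pdivrMr ?exprn_gt0//.
  rewrite mulrC -ler_pdivrMr// (le_trans (ltW (truncnS_gt _)))//.
  by rewrite -natrX ler_nat ltnW// ltn_expl.
move=> /ex_minnP[[|e] ex emin]; first by move: ex; rewrite expr0 invr1; lra.
exists e.+1; rewrite ex /= leNgt; apply/negP => xe.
suff /emin : 8 * (2 ^+ e)^-1 <= x by rewrite ltnn.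
by apply: le_trans (ltW xe); rewrite exprS invfM; lra.
Qed.

Lemma absz_shift (M : nat) (m : int) : `|m| <= M%:Z ->
  (`|(m + M%:Z)%R|%N < (2 * M).+1)%N /\ (`|(m + M%:Z)%R|%N)%:Z - M%:Z = m.
Proof. by lia. Qed.

(** A Whitney-type cover of the part of S off the closure of T: the radius of a
ball is comparable with the distance to T, here called its scale.  The balls are
indexed by the points c i of the dyadic grids.  A grid point is used when some s
of S is close to it at the right scale; the ball is then centred at a hole of E
near s, and its radius is chosen so that its boundary avoids the previous
centres.  Near a point at positive distance from T only finitely many scales and
grid points occur.  A point x of E in the closure of T is at positive distance
from S, and the balls, being small with respect to the distance from S to x,
stay away from x. *)
Lemma locally_finite_ball_cover (R : realType) n (E S T : set 'rV[R]_n) :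
  (forall s, S s -> forall e, 0 < e -> exists2 p, ~ E p & `|s - p| < e) ->
  (forall x, E x -> tdist T x = 0 -> 0 < tdist S x) ->
  exists (p : nat -> 'rV[R]_n) (r : nat -> R),
    [/\ forall k, 0 < r k -> ~ E (p k),
        forall i k, (i < k)%N -> `|p i - p k| != r k,
        forall x, E x -> exists N d, 0 < d /\
          forall k y, (N <= k)%N -> `|y - x| < d -> r k < `|y - p k|,
        forall k y, `|y - p k| <= r k -> 0 < tdist T y &
        forall s, S s -> 0 < tdist T s -> exists k, `|s - p k| < r k].
Proof.
move=> holes ST; pose I : countType := (nat * {ffun 'I_n -> int})%type; pose h e : R := (2 ^+ e)^-1.
have h0 e : 0 < h e by rewrite invr_gt0 exprn_gt0.
have h1 e : h e <= 1 by rewrite invf_le1 ?exprn_gt0// exprn_ege1// ler1n.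
pose c (i : nat * {ffun 'I_n -> int}) : 'rV[R]_n := \row_j ((i.2 j)%:~R * h i.1).
pose sel i s := [/\ S s, `|s - c i| <= h i.1 & 8 * h i.1 <= tdist T s <= 16 * h i.1].
have /choice[b bP] : forall i, exists b : 'rV[R]_n * 'rV[R]_n, (exists s, sel i s) ->
    [/\ sel i b.1, ~ E b.2 & `|b.1 - b.2| < h i.1].
  move=> i; have [[s si]|] := pselect (exists s, sel i s); last first.
    by exists (0, 0).
  have [Ss _ _] := si; have [p Ep sp] := holes s Ss _ (h0 i.1).
  by exists (s, p).
pose p k := if @pickle_inv I k is Some i then (b i).2 else 0.
pose chosen k (i : I) := pickle_inv k = Some i /\ exists s, sel i s.
(* Indices without a ball receive radius -1. *)
have /choice[r rP] : forall k, exists rk, [/\ forall i, (i < k)%N -> `|p i - p k| != rk,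
    forall i, chosen k i -> 3 * h i.1 < rk < 4 * h i.1 &
    (forall i, ~ chosen k i) -> rk = -1].
  move=> k; have [[i ki]|nk] := pselect (exists i, chosen k i); last first.
    exists (-1); split => [i _|i ki|//]; last by case: nk; exists i.
    by rewrite gt_eqF// (lt_le_trans (ltrN10 _)).
  have hi : 3 * h i.1 < 4 * h i.1 by rewrite ltr_pM2r// ltr_nat.
  have [x xh xl] := exists_between_notin [seq `|p j - p k| | j <- iota 0 k] hi.
  exists x; split => [j jk|j [kj _]|/(_ i)//].
    apply: contraNneq xl => <-; apply/mapP; exists j => //.
    by rewrite mem_iota.
  by case: ki => ki _; move: kj; rewrite ki => -[<-].
have chosenP k y : `|y - p k| <= r k -> exists i, [/\ chosen k i, r k < 4 * h i.1,
    `|y - (b i).1| < 5 * h i.1 & sel i (b i).1].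
  move=> yk; have [_ r1 r2] := rP k.
  have [[i ki]|nk] := pselect (exists i, chosen k i); last first.
    have := le_trans (normr_ge0 _) yk; rewrite r2 ?ler0N1// => i ki.
    by apply: nk; exists i.
  have /andP[_ ri] := r1 i ki; have [ki' si] := ki; have [sb _ bb] := bP i si.
  exists i; split => //; have pk : p k = (b i).2 by rewrite /p ki'.
  have := ler_distD (p k) y (b i).1; rewrite (distrC (p k)); rewrite -pk in bb; lra.
have rho_ball y i : `|y - (b i).1| < 5 * h i.1 -> sel i (b i).1 ->
    3 * h i.1 <= tdist T y <= 21 * h i.1 /\ `|y - c i| <= 6 * h i.1.
  move=> ys [_ sc /andP[s1 s2]].
  have /ler_normlP[] := tdist_lip T y (b i).1.
  have := ler_distD (b i).1 y (c i).
  by split; [apply/andP; split|]; lra.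
exists p, r; split.
- move=> k rk; have [|i [[ki si] _ _ _]] := chosenP k (p k).
    by rewrite subrr normr0 ltW.
  by rewrite /p ki; have [] := bP i si.
- by move=> i k ik; have [+ _ _] := rP k; apply.
- move=> x Ex; have := tdist_ge0 T x; rewrite le_eqVlt => /predU1P[/esym x0|x0].
    have a0 := ST x Ex x0; exists 0%N, (3 / 8 * tdist S x); split; first by lra.
    move=> k y _ yx; rewrite ltNge; apply/negP => /chosenP[i [_ _ ys [Ss _ /andP[s1 _]]]].
    have := tdist_le x Ss; have := tdist_leD T (b i).1 x; rewrite x0 (distrC x).
    have := ler_distD y (b i).1 x; rewrite (distrC (b i).1 y).
    have := h0 i.1; lra.
  pose B := 42 / tdist T x; pose K := (Num.truncn B).+1.
  pose M := (Num.truncn (B * (`|x| + 7))).+1.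
  pose phi (a : 'I_K * {ffun 'I_n -> 'I_(2 * M).+1}) : nat * {ffun 'I_n -> int} :=
    (val a.1, [ffun j => (a.2 j)%:Z - M%:Z]).
  exists (\max_a pickle (phi a)).+1, (tdist T x / 2); split; first by rewrite divr_gt0.
  move=> k y Nk yx; rewrite ltNge; apply/negP => /chosenP[i [[ki si] _ ys sb]].
  have [/andP[_ rho_y] yc] := rho_ball y i ys sb.
  have hB : (h i.1)^-1 <= B.
    rewrite /B ler_pdivlMr// mulrC ler_pdivrMr//.
    have /ler_normlP[] := tdist_lip T y x; lra.
  have iK : (i.1 < K)%N.
    rewrite -(ltr_nat R); apply: (lt_trans _ (truncnS_gt _)); apply: lt_le_trans hB.
    by rewrite invrK -natrX ltr_nat ltn_expl.
  have iM j : `|i.2 j| <= M%:Z.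
    rewrite -(ler_int R) intr_norm; apply/ltW/(le_lt_trans _ (truncnS_gt _)).
    have cx : `|c i| <= `|x| + 7.
      have := ler_distD y (c i) 0; have := ler_distD x y 0; rewrite !subr0 (distrC (c i)).
      have := tdist_le1 T x; have := h1 i.1; lra.
    have := le_trans (coord_le_norm (c i) j) cx.
    rewrite mxE normrM (gtr0_norm (h0 _)) -ler_pdivlMr// => /le_trans; apply.
    by rewrite mulrC ler_wpM2r// addr_ge0.
  suff ia : phi (inord i.1, [ffun j => inord `|(i.2 j + M%:Z)%R|%N]) = i.
    move: Nk; rewrite ltnNge => /negP; apply.
    have -> : k = pickle i by have := @pickle_invK I k; rewrite ki.
    by rewrite -{1}ia; exact: (leq_bigmax _).
  rewrite [RHS]surjective_pairing /phi /= inordK//; congr pair; apply/ffunP => j.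
  by have [mM mK] := absz_shift (iM j); rewrite !ffunE inordK.
- move=> k y /chosenP[i [_ _ ys sb]]; have [/andP[+ _] _] := rho_ball y i ys sb.
  by apply: lt_le_trans; rewrite mulr_gt0.
- move=> s Ss s0; have [|e se] := @dyadic_scale _ (tdist T s).
    by rewrite s0 tdist_le1.
  pose i := (e, [ffun j => Num.floor (s 0 j / h e)] : {ffun 'I_n -> int}).
  have si : sel i s.
    split => //; apply: norm_le_coord => [|j]; first exact: ltW.
    have /andP[t1 t2] := floor_itv (s 0 j / h e).
    rewrite !mxE ffunE /= -[in X in X - _](divfK (negbT (gt_eqF (h0 e))) (s 0 j)).
    rewrite -mulrBl normrM (gtr0_norm (h0 e)) ler_piMl ?(ltW (h0 e))//.
    by rewrite ger0_norm ?subr_ge0// lerBlDr addrC -intrD1 ltW.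
  have ki : chosen (pickle i) i by split; [rewrite pickleK_inv|exists s].
  exists (pickle i); have [_ /(_ i ki)/andP[ri _] _] := rP (pickle i).
  apply: le_lt_trans ri; have pk : p (pickle i) = (b i).2 by rewrite /p pickleK_inv.
  have [|[_ bc _] _ bb] := bP i; first by exists s.
  have [_ sc _] := si; rewrite pk.
  have := ler_distD (c i) s (b i).2; have := ler_distD (b i).1 (c i) (b i).2.
  rewrite (distrC (c i) (b i).1); lra.
Qed.

(** * The approximation *)

Lemma continuous_subc (R : realType) (V W : normedModType R) (f : V -> W) v x :
  {for x, continuous f} -> {for x, continuous (fun y => f y - v)}.
Proof. by move=> fx; apply: cvgB => //; exact: cvg_cst. Qed.

Lemma interior_norm_ball (R : realType) (V : normedModType R) (E : set V) s d :
  0 < d -> (forall y, `|s - y| < d -> E y) -> interior E s.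
Proof. by move=> d0 sE; apply/nbhs_normP; exists d => //= y; exact: sE. Qed.

Lemma cutoff_continuous (R : realType) (e : R) :
  continuous (fun t : R => Num.min 1 (Num.max 0 (2 - t / e)) : R).
Proof.
move=> t; apply: (@continuous_min R R (fun=> 1) (fun t : R => Num.max 0 (2 - t / e))).
  exact: cvg_cst.
apply: (@continuous_max R R (fun=> 0) (fun t : R => 2 - t / e)); first exact: cvg_cst.
apply: cvgB; first exact: cvg_cst.
by apply: cvgM; [exact: cvg_id|exact: cvg_cst].
Qed.

Lemma convex_comb_gt0 (R : realType) (l a b : R) :
  0 <= l -> l <= 1 -> 0 < a -> 0 < b -> 0 < (1 - l) * a + l * b.
Proof.
move=> l0 l1 a0 b0; have [lh|lh] := leP l (1 / 2).
  by apply: ltr_pwDl; [rewrite mulr_gt0//; lra|rewrite mulr_ge0// ltW].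
by apply: ltr_wpDl; [rewrite mulr_ge0 ?(ltW a0)//; lra|rewrite mulr_gt0//; lra].
Qed.

(** The statement for the sup norm; the Euclidean one follows by comparison of
the two norms. *)
Lemma sup_norm_zero_free_approx (R : realType) n (E : set 'rV[R]_n.+1)
    (f : 'rV[R]_n.+1 -> 'rV[R]_n.+1) (e : R) :
  0 < e -> {within E, continuous f} -> zero_free_on (interior E) f ->
  exists g : 'rV[R]_n.+1 -> 'rV[R]_n.+1,
    [/\ {within E, continuous g}, zero_free_on E g &
        forall x, E x -> `|f x - g x| <= 4 * e].
Proof.
move=> e0 /subspace_continuousP f_cont f_free.
have fn_cont x : E x -> `|f y| @[y --> within E (nbhs x)] --> `|f x|.
  by move=> Ex; apply: cvg_norm; exact: f_cont.
have fj_cont x j : E x -> f y 0 j @[y --> within E (nbhs x)] --> f x 0 j.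
  move=> Ex; exact: (cvg_comp _ _ (f_cont x Ex) (@coord_continuous _ _ _ 0 j (f x))).
pose T : set 'rV[R]_n.+1 := [set x | E x /\ 0 <= `|f x| - e].
pose A0 j (b : bool) : set 'rV[R]_n.+1 :=
  [set x | E x /\ 0 <= (-1) ^+ b * f x 0 j - `|f x|].
pose S : set 'rV[R]_n.+1 :=
  [set x | exists j, tdist (A0 j false) x = 0 /\ tdist (A0 j true) x = 0].
have clT x : E x -> tdist T x = 0 -> e <= `|f x|.
  move=> Ex Tx; rewrite -subr_ge0.
  apply: (tdist_superlevel (phi := fun y => `|f y| - e) Ex _ Tx).
  by apply: cvgB; [exact: fn_cont|exact: cvg_cst].
have clA0 x j b : E x -> tdist (A0 j b) x = 0 -> `|f x| <= (-1) ^+ b * f x 0 j.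
  move=> Ex Ax; rewrite -subr_ge0.
  apply: (tdist_superlevel (phi := fun y => (-1) ^+ b * f y 0 j - `|f y|) Ex _ Ax).
  apply: cvgB; last exact: fn_cont.
  by apply: cvgM; [exact: cvg_cst|exact: fj_cont].
(* The next two facts say that S meets E exactly in the zeros of f. *)
have SE x : E x -> S x -> f x = 0.
  move=> Ex [j [/(clA0 _ _ _ Ex) + /(clA0 _ _ _ Ex)]]; rewrite expr0 expr1 => ? ?.
  by apply/eqP; rewrite -normr_le0; lra.
have ZS x : E x -> f x = 0 -> S x.
  by move=> Ex fx; exists ord0; rewrite !tdist0//; split => //; rewrite fx mxE normr0 mulr0 subr0.
have holes s : S s -> forall d, 0 < d -> exists2 p, ~ E p & `|s - p| < d.
  move=> Ss d d0; apply: contrapT => nop.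
  have sE y : `|s - y| < d -> E y by move=> sy; apply: contrapT => Ey; apply: nop; exists y.
  have Es : E s by apply: sE; rewrite subrr normr0.
  suff /f_free : interior E s by rewrite SE// eqxx.
  exact: interior_norm_ball d0 sE.
have ST x : E x -> tdist T x = 0 -> 0 < tdist S x.
  move=> Ex /(clT _ Ex) ex.
  have Sx : ~ S x by move=> /(SE _ Ex) fx; move: ex; rewrite fx normr0 leNgt e0.
  have [j|q qx] := @urysohn_map_den_ge _ _ (fun j => A0 j false) (fun j => A0 j true) x.
    rewrite lt_neqAle urysohn_den_ge0 andbT eq_sym; apply/negP.
    rewrite paddr_eq0 ?tdist_ge0// => /andP[/eqP ? /eqP ?].
    by apply: Sx; exists j.
  have c0 : 0 < q.+1%:R^-1 :> R by rewrite invr_gt0 ltr0n.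
  have c1 : q.+1%:R^-1 <= 1 :> R by rewrite invf_le1 ?ltr0n// ler1n.
  move: (q.+1%:R^-1 : R) c0 c1 qx => c c0 c1 qx.
  apply: (@lt_le_trans _ _ (c / 2)); first by rewrite divr_gt0.
  apply: tdist_ge => [|s [j [s1 s2]]]; first by lra.
  have := qx j; rewrite /urysohn_den /=.
  have := tdist_leD (A0 j false) x s; have := tdist_leD (A0 j true) x s.
  by rewrite s1 s2; lra.
have [p [r [pE p_sphere lf ballT cover]]] := locally_finite_ball_cover holes ST.
pose N : set 'rV[R]_n.+1 := [set x | exists k, `|x - p k| < r k].
pose A j b := A0 j b `\` N.
(* A common zero of both distances would be in S and outside the open set N,
   although the balls cover S off the closure of T. *)
have den_gt0 x : E x \/ 0 < tdist T x ->
    forall j, 0 < urysohn_den (A j false) (A j true) x.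
  move=> xET j; rewrite lt_neqAle urysohn_den_ge0 andbT eq_sym; apply/negP.
  rewrite paddr_eq0 ?tdist_ge0// => /andP[/eqP Ax1 /eqP Ax2].
  have A0x b : tdist (A j b) x = 0 -> tdist (A0 j b) x = 0.
    move=> Ax; apply/le_anti; rewrite tdist_ge0 andbT -Ax.
    by apply: tdist_sub => y [].
  have Sx : S x by exists j; rewrite !A0x.
  have Tx : 0 < tdist T x.
    case: xET => // Ex; rewrite lt_neqAle tdist_ge0 andbT eq_sym; apply/eqP => /(ST _ Ex).
    by rewrite tdist0// ltxx.
  have [k xk] := cover x Sx Tx.
  have xk0 : 0 < r k - `|x - p k| by rewrite subr_gt0.
  have [a [_ Na] xa] := tdist_eq0_near Ax1 xk0.
  by apply: Na; exists k; have := ler_distD x a (p k); rewrite (distrC a x); lra.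
pose H := urysohn_map (fun j => A j false) (fun j => A j true).
have sphere_den k y : `|y - p k| = r k -> forall j, 0 < urysohn_den (A j false) (A j true) y.
  by move=> yk; apply: den_gt0; right; apply: (ballT k); rewrite yk.
have [v v_small vH] := urysohn_map_generic sphere_den.
pose Omega : set 'rV[R]_n.+1 := [set y | forall j, 0 < urysohn_den (A j false) (A j true) y].
have g0_sphere k y : `|y - p k| = r k -> Omega y /\ H y - v != 0.
  move=> yk; split; first by move=> j; exact: (sphere_den k y yk j).
  by rewrite subr_eq0 (vH k).
have g0_cont y : Omega y -> {for y, continuous (fun y => H y - v)}.
  by move=> Oy; apply: continuous_subc; exact: urysohn_map_continuous.
have g0_le z : `|H z - v| <= 2.
  apply: le_trans (ler_normB _ _) _.
  by have := urysohn_map_le1 (fun j => A j false) (fun j => A j true) z; rewrite -/(H z); lra.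
have EOmega x : E x -> Omega x /\ forall i, 0 < r i -> x != p i.
  move=> Ex; split; first by apply: den_gt0; left.
  by move=> i /pE pi; apply: contra_not_neq pi => <-.
have [G [Gcont Gball Gout Gle]] :=
  push_zeros_off (fun i k ik _ => p_sphere i k ik) g0_sphere g0_cont g0_le EOmega lf.
pose lam (t : R) : R := Num.min 1 (Num.max 0 (2 - t / e)).
have lam_ge0 t : 0 <= lam t by rewrite le_min ler01 le_max lexx.
have lam_le1 t : lam t <= 1 by rewrite ge_min lexx.
exists (fun x => (1 - lam `|f x|) *: f x + (lam `|f x| * e) *: G x); split.
- apply/subspace_continuousP => x Ex.
  have lam_cont : lam `|f y| @[y --> within E (nbhs x)] --> lam `|f x|.
    by exact: (cvg_comp _ _ (fn_cont x Ex) (@cutoff_continuous _ e _)).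
  apply: cvgD; apply: cvgZ; [|exact: f_cont| |exact: Gcont].
    by apply: cvgB; [exact: cvg_cst|exact: lam_cont].
  by apply: cvgM; [exact: lam_cont|exact: cvg_cst].
- (* In a ball |f x| < e, so the interpolation gives e *: G x.  Elsewhere the
     coordinate j realising the norm of f x has the sign of the same coordinate
     of G x, because the latter is 1 or -1 up to v. *)
  move=> x Ex; have [[k xk]|xout] := pselect (exists k, `|x - p k| <= r k).
    have fx : `|f x| < e.
      rewrite ltNge -subr_ge0; apply/negP => fx.
      by have := ballT k x xk; rewrite tdist0 ?ltxx.
    have -> : lam `|f x| = 1.
      rewrite /lam max_r; last by rewrite subr_ge0 ler_pdivrMr//; lra.
      by rewrite min_l// lerBrDr -lerBrDl ler_pdivrMr//; lra.
    by rewrite subrr scale0r add0r mul1r scaler_eq0 gt_eqF//= (Gball _ k).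
  have {}xout k : r k < `|x - p k| by rewrite ltNge; apply/negP => xk; apply: xout; exists k.
  have Nx : ~ N x by move=> [k]; rewrite ltNge ltW.
  have fx0 : f x != 0.
    apply/eqP => /(ZS _ Ex) Sx; apply: Nx; apply: (cover x Sx).
    by rewrite lt_neqAle tdist_ge0 andbT eq_sym; apply/eqP => /(ST _ Ex); rewrite tdist0// ltxx.
  rewrite (Gout x Ex xout); have [j fj] := norm_coord (f x).
  have den := den_gt0 x (or_introl Ex) j.
  have := le_lt_trans (coord_le_norm v j) v_small; rewrite ltr_norml => /andP[v1 v2].
  apply/eqP => /rowP/(_ j); rewrite !mxE; apply/eqP.
  have [l0 l1] := (lam_ge0 `|f x|, lam_le1 `|f x|).
  have fj0 : f x 0 j != 0 by rewrite -normr_gt0 -fj normr_gt0.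
  have [fj_gt0|fj_le0] := ltP 0 (f x 0 j).
    have -> : urysohn (A j false) (A j true) x = 1.
      by apply: urysohn_left => //; split => //; split => //;
        rewrite expr0 mul1r fj gtr0_norm// subrr.
    by rewrite gt_eqF// -mulrA convex_comb_gt0// mulr_gt0//; lra.
  have fj_lt0 : f x 0 j < 0 by rewrite lt_neqAle fj0.
  have -> : urysohn (A j false) (A j true) x = -1.
    by apply: urysohn_right => //; split => //; split => //;
      rewrite expr1 mulN1r fj ltr0_norm// subrr.
  have mix : 0 < (1 - lam `|f x|) * - f x 0 j + lam `|f x| * (e * (1 + v 0 j)).
    by rewrite convex_comb_gt0 ?oppr_gt0// mulr_gt0//; lra.
  by rewrite lt_eqF//; lra.
- move=> x Ex.
  have -> : f x - ((1 - lam `|f x|) *: f x + (lam `|f x| * e) *: G x) =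
      lam `|f x| *: (f x - e *: G x).
    by rewrite scalerBl scale1r scalerBr scalerA opprD opprB addrA [X in X - _]addrC subrK.
  rewrite normrZ ger0_norm//; have [fx|fx] := leP (2 * e) `|f x|.
    suff -> : lam `|f x| = 0 by rewrite mul0r mulr_ge0 ?(ltW e0).
    by rewrite /lam max_l ?min_r// subr_le0 ler_pdivlMr.
  rewrite -[leRHS]mul1r ler_pM//; apply: le_trans (ler_normB _ _) _.
  have := Gle x; rewrite normrZ gtr0_norm// => Gx.
  have : e * `|G x| <= e * 2 by rewrite ler_wpM2l// ltW.
  lra.
Qed.

Lemma enorm_le_norm (R : realType) n (x : 'rV[R]_n.+1) : enorm x <= n.+1%:R * `|x|.
Proof.
rewrite /enorm -[leRHS]ger0_norm ?mulr_ge0// -sqrtr_sqr ler_wsqrtr//.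
apply: (@le_trans _ _ (\sum_(i < n.+1) `|x| ^+ 2)).
  apply: ler_sum => i _; rewrite -[x 0 i ^+ 2]ger0_norm ?sqr_ge0// normrX.
  by rewrite lerXn2r ?nnegrE// coord_le_norm.
rewrite sumr_const card_ord -[leLHS]mulr_natl exprMn ler_wpM2r ?sqr_ge0//.
by rewrite -natrX ler_nat leq_pmulr.
Qed.

Theorem theorem1p1 (R : realType) (n : nat) (n_gt0 : (0 < n)%N)
    (E : set 'rV[R]_n) (f : 'rV[R]_n -> 'rV[R]_n)
    (f_cont : {within E, continuous f})
    (f_free : zero_free_on (interior E) f) :
  forall eps : R, 0 < eps ->
    exists g : 'rV[R]_n -> 'rV[R]_n,
      [/\ {within E, continuous g},
          zero_free_on E g &
          forall x : 'rV[R]_n, E x -> enorm (f x - g x) < eps].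
Proof.
case: n n_gt0 E f f_cont f_free => // n _ E f f_cont f_free eps eps0.
have e0 : 0 < eps / (8 * n.+1%:R) by rewrite divr_gt0// mulr_gt0.
have [g [g_cont g_free fg]] := sup_norm_zero_free_approx e0 f_cont f_free.
exists g; split => // x Ex; apply: le_lt_trans (enorm_le_norm _) _.
apply: (@le_lt_trans _ _ (eps / 2)); last by lra.
apply: le_trans (ler_wpM2l _ (fg x Ex)) _ => //.
rewrite le_eqVlt; apply/orP; left; apply/eqP; field.
by rewrite gt_eqF.
Qed.
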